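(* Let $\kappa\in(0,4)$ and let $\alpha,\beta$ be the two roots of $m^2+(2-\kappa)m+1=0$; they are complex conjugate and non-real, and we label them so that $\operatorname{Im}\alpha>0$ and $\beta=\overline{\alpha}$. Define, for $\tau\ge 0$, $$u_0(\tau)=1+\frac{\sqrt{\kappa}}{\alpha-\beta}\left[\frac{e^{\alpha\tau}\operatorname{Erfc}\sqrt{\alpha\tau}}{\sqrt{\alpha}}-\frac{e^{\beta\tau}\operatorname{Erfc}\sqrt{\beta\tau}}{\sqrt{\beta}}\right].$$ Then $u_0$ is real-valued, $u_0'(\tau)>0$ for every $\tau>0$, and $u_0(\tau)\to 1$ as $\tau\to\infty$. In particular $u_0$ approaches the limit $1$ monotonically (increasingly).
   Context: $\operatorname{Erfc}$ denotes the complementary error function extended to an entire function of $z\in\mathbb{C}$: $\operatorname{Erfc}(z)=1-\frac{2}{\sqrt{\pi}}\int_0^z e^{-s^2}\,ds$. Square roots of complex numbers are principal square roots (argument in $(-\pi/2,\pi/2]$). *)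

(* Defs.v *)
From Stdlib Require Import Reals.
From Coquelicot Require Import Coquelicot.
Open Scope R_scope.

Definition Cexp (z : C) : C :=
  (exp (Re z) * cos (Im z), exp (Re z) * sin (Im z)).

(* principal square root (argument in (-pi/2, pi/2]):
   sqrt(x+iy) = sqrt((|z|+x)/2) + i sgn(y) sqrt((|z|-x)/2), with sgn(0) := +1 *)
Definition Csqrt (z : C) : C :=
  (sqrt ((Cmod z + Re z) / 2),
   (if Rlt_dec (Im z) 0 then -1 else 1) * sqrt ((Cmod z - Re z) / 2)).

(* int_0^z e^{-s^2} ds along the segment s = t z, t in [0,1] *)
Definition int0_gauss (z : C) : C :=
  @RInt C_R_CompleteNormedModule
    (fun t : R => Cmult (Cexp (Copp (Cmult (Cmult (RtoC t) z) (Cmult (RtoC t) z)))) z)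
    0 1.

Definition Erfc (z : C) : C :=
  Cminus (RtoC 1) (Cmult (RtoC (2 / sqrt PI)) (int0_gauss z)).

Definition u0 (kappa : R) (alpha beta : C) (tau : R) : C :=
  Cplus (RtoC 1)
    (Cmult (Cdiv (RtoC (sqrt kappa)) (Cminus alpha beta))
       (Cminus
          (Cdiv (Cmult (Cexp (Cmult alpha (RtoC tau))) (Erfc (Csqrt (Cmult alpha (RtoC tau)))))
                (Csqrt alpha))
          (Cdiv (Cmult (Cexp (Cmult beta (RtoC tau))) (Erfc (Csqrt (Cmult beta (RtoC tau)))))
                (Csqrt beta)))).

(* Main.v *)
(** Write [a = sqrt alpha = a1 + i a2], so that [|a| = 1] and [sqrt kappa = 2 a1], and
    [y(t) = e^(alpha t) Erfc(sqrt(alpha t)) / a]. Then [u0 = 1 + Im y / a2], and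
    [u0' = Im (alpha y) / a2]. Both are read off the Stieltjes representation
      [y(t) = (2/pi) int_0^oo e^(-t x^2) / (x^2 + alpha) dx],
    which gives [Im y] the integrand [- Im alpha e^(-t x^2) / |x^2 + alpha|^2], of size
    [O(1 / sqrt t)] after integration, and [Im (alpha y)] the positive integrand
    [Im alpha x^2 e^(-t x^2) / |x^2 + alpha|^2].

    The representation is obtained as a limit of integrals over [0, N]. With
    [E(x) = int_0^x e^(-s^2) ds], the function
    [M_N(r) = int_0^N e^(-r^2 (x^2 + alpha)) / (x^2 + alpha) dx] satisfies
    [M_N'(r) = -2 e^(-alpha r^2) E(N r)]; moreover [M_N(0)] is elementary and tends to
    [pi / (2 a)], and [E(N s) -> sqrt pi / 2] with error [O(1 / (1 + N^2 s^2))]. *)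

Require Import Defs.
From Stdlib Require Import Reals Lra.
From Coquelicot Require Import Coquelicot.
Open Scope R_scope.

(** * Real forms of the integrands *)

Definition gauss (x : R) : R := exp (- (x * x)).

(* [Re ((p + i q) e^(- alpha s^2))] with [alpha = c + i S]. *)
Definition osc (c S p q s : R) : R :=
  exp (- (c * (s * s))) * (p * cos (S * (s * s)) + q * sin (S * (s * s))).

(* [|x^2 + alpha|^2] *)
Definition denom (c S x : R) : R := (x * x + c) * (x * x + c) + S * S.

(* [Re ((p + i q) e^(- r^2 (x^2 + alpha)) / (x^2 + alpha))]; carrying a general [p + i q]
   treats the real and imaginary parts at once. *)
Definition stieltjes (c S p q r x : R) : R :=
  exp (- (r * r * (x * x + c))) *
  (p * (cos (S * (r * r)) * (x * x + c) - sin (S * (r * r)) * S) +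
   q * (sin (S * (r * r)) * (x * x + c) + cos (S * (r * r)) * S)) / denom c S x.

(** * Integrals of everywhere differentiable real functions *)

Lemma ex_RInt_of_ex_derive (f : R -> R) (a b : R) :
  (forall x, ex_derive f x) -> ex_RInt f a b.
Proof.
intros H; apply (ex_RInt_continuous f); intros; now apply (ex_derive_continuous f).
Qed.

Lemma RInt_Rext (f g : R -> R) (a b : R) :
  (forall x, f x = g x) -> RInt f a b = RInt g a b.
Proof. intros H; apply RInt_ext; intros; apply H. Qed.

Lemma RInt_Rmult (f : R -> R) (k a b : R) :
  ex_RInt f a b -> RInt (fun x => k * f x) a b = k * RInt f a b.
Proof. exact (RInt_scal f a b k). Qed.

Lemma RInt_of_is_derive (f df : R -> R) (a b : R) :
  (forall x, is_derive f x (df x)) -> (forall x, ex_derive df x) ->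
  RInt df a b = f b - f a.
Proof.
intros Hf Hdf; apply (is_RInt_unique (V := R_CompleteNormedModule)).
apply (is_RInt_derive f df); intros x _; [apply Hf|].
now apply (ex_derive_continuous df).
Qed.

Lemma is_derive_RInt_upper (f : R -> R) (a x : R) :
  (forall y, ex_derive f y) -> is_derive (fun b => RInt f a b) x (f x).
Proof.
intros H; apply (is_derive_RInt f _ a x).
- apply filter_forall; intros y; apply (RInt_correct f), ex_RInt_of_ex_derive, H.
- now apply (ex_derive_continuous f).
Qed.

Lemma is_derive_scaled_primitive (f : R -> R) (k x : R) :
  (forall y, ex_derive f y) ->
  is_derive (fun s => RInt f 0 (k * s)) x (k * f (k * x)).
Proof.
intros H.
apply (is_derive_comp (fun b => RInt f 0 b) (fun s => k * s)).
- now apply is_derive_RInt_upper.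
- auto_derive; [trivial|ring].
Qed.

(** * The truncated Stieltjes integral as a function of [r] *)

Lemma ex_derive_gauss (x : R) : ex_derive gauss x.
Proof. unfold gauss; auto_derive; trivial. Qed.

Lemma ex_derive_osc (c S p q s : R) : ex_derive (osc c S p q) s.
Proof. unfold osc; auto_derive; trivial. Qed.

Lemma ex_derive_stieltjes_x (c S p q r x : R) :
  denom c S x <> 0 -> ex_derive (stieltjes c S p q r) x.
Proof. unfold stieltjes, denom; intros H; auto_derive; trivial. Qed.

(** Differentiating the exponential brings down [-2 r (x^2 + alpha)], which cancels the denominator;
    the rest splits into a factor in [r] alone and a Gaussian in [r x]. *)
Lemma is_derive_stieltjes_r (c S p q r x : R) :
  denom c S x <> 0 ->
  is_derive (fun r => stieltjes c S p q r x) r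
    (-2 * osc c S p q r * (r * gauss (r * x))).
Proof.
unfold stieltjes, osc, gauss; intros H.
auto_derive; [trivial|].
replace (exp (- (r * r * (x * x + c)))) with
  (exp (- (c * (r * r))) * exp (- (r * x * (r * x)))).
2:{ rewrite <- exp_plus; f_equal; ring. }
unfold denom in *. field. exact H.
Qed.

(** Differentiation under the integral sign, the explicit derivative being jointly continuous; the
    substitution [s = r x] then produces the Gaussian primitive at [N r]. *)
Lemma is_derive_RInt_stieltjes (c S p q N r : R) :
  (forall x, denom c S x <> 0) ->
  is_derive (fun r => RInt (stieltjes c S p q r) 0 N) r
    (-2 * osc c S p q r * RInt gauss 0 (N * r)).
Proof.
intros HD.
assert (Hd : forall s x, Derive (fun r => stieltjes c S p q r x) s =
  -2 * osc c S p q s * (s * gauss (s * x))).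
{ intros s x; apply is_derive_unique, is_derive_stieltjes_r, HD. }
replace (-2 * osc c S p q r * RInt gauss 0 (N * r)) with
  (RInt (fun x => Derive (fun r => stieltjes c S p q r x) r) 0 N).
- apply (is_derive_RInt_param (fun r x => stieltjes c S p q r x) 0 N r).
  + apply filter_forall; intros s x _; eexists; apply is_derive_stieltjes_r, HD.
  + intros x _.
    apply (continuity_2d_pt_ext
      (fun s x => (-2 * osc c S p q s * s) * gauss (s * x))).
    { intros; rewrite Hd; ring. }
    apply continuity_2d_pt_mult.
    * apply (continuity_1d_2d_pt_comp (fun s => -2 * osc c S p q s * s) (fun s _ => s)).
      2: apply continuity_2d_pt_id1.
      apply continuity_pt_filterlim.
      apply (ex_derive_continuous (fun s => -2 * osc c S p q s * s)).
      unfold osc; auto_derive; trivial.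
    * apply (continuity_1d_2d_pt_comp gauss (fun s x => s * x)).
      -- apply continuity_pt_filterlim, (ex_derive_continuous gauss), ex_derive_gauss.
      -- apply continuity_2d_pt_mult; [apply continuity_2d_pt_id1|apply continuity_2d_pt_id2].
  + apply filter_forall; intros s; apply ex_RInt_of_ex_derive; intros x.
    now apply ex_derive_stieltjes_x.
(* The added [0] gives the integrand the shape of an affine substitution. *)
- rewrite (RInt_Rext _ (fun x => -2 * osc c S p q r * (r * gauss (r * x + 0)))).
  2:{ intros x; rewrite Hd, Rplus_0_r; reflexivity. }
  rewrite RInt_Rmult.
  2:{ apply ex_RInt_of_ex_derive; intros x; unfold gauss; auto_derive; trivial. }
  f_equal.
  transitivity (RInt gauss (r * 0 + 0) (r * N + 0)).
  2: f_equal; ring.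
  apply (RInt_comp_lin gauss r 0 0 N).
  apply ex_RInt_of_ex_derive, ex_derive_gauss.
Qed.

Lemma RInt_stieltjes_eq (c S p q N r : R) :
  (forall x, denom c S x <> 0) ->
  RInt (stieltjes c S p q r) 0 N =
  RInt (stieltjes c S p q 0) 0 N -
  2 * RInt (fun s => osc c S p q s * RInt gauss 0 (N * s)) 0 r.
Proof.
intros HD.
assert (Hex : forall s, ex_derive (fun s => osc c S p q s * RInt gauss 0 (N * s)) s).
{ intros s; apply @ex_derive_mult; [apply ex_derive_osc|].
  eexists; apply is_derive_scaled_primitive, ex_derive_gauss. }
assert (H := RInt_of_is_derive (fun r => RInt (stieltjes c S p q r) 0 N)
  (fun r => -2 * (osc c S p q r * RInt gauss 0 (N * r))) 0 r).
rewrite RInt_Rmult in H by (apply ex_RInt_of_ex_derive, Hex).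
cbv beta in H; rewrite <- (Rplus_minus (RInt (stieltjes c S p q 0) 0 N) (RInt (stieltjes c S p q r) 0 N)).
unfold Rminus at 2; apply Rplus_eq_compat_l.
replace (- (2 * RInt (fun s => osc c S p q s * RInt gauss 0 (N * s)) 0 r)) with
  (-2 * RInt (fun s => osc c S p q s * RInt gauss 0 (N * s)) 0 r) by ring.
symmetry; apply H.
- intros s; rewrite <- Rmult_assoc; now apply is_derive_RInt_stieltjes.
- intros s; apply ex_derive_scal, Hex.
Qed.

(** * The Gaussian primitive: upper bound and tail *)

(* [E(x)^2 + int_0^1 exp(-x^2(1+u^2))/(1+u^2) du] is constant: its second term is
   the Stieltjes integral with [c = 1], [S = 0], [N = 1]. *)
Lemma gauss_primitive_sqr (x : R) :
  RInt gauss 0 x * RInt gauss 0 x + RInt (stieltjes 1 0 1 0 x) 0 1 = PI / 4.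
Proof.
assert (HD : forall x, denom 1 0 x <> 0) by (intros y; unfold denom; nra).
rewrite RInt_stieltjes_eq by exact HD.
assert (H0 : RInt (stieltjes 1 0 1 0 0) 0 1 = PI / 4).
{ transitivity (atan 1 - atan 0); [|rewrite atan_1, atan_0; apply Rminus_0_r].
  rewrite (RInt_Rext _ (fun u => / (1 + u ^ 2))).
  2:{ intros u; unfold stieltjes, denom.
    replace (- (0 * 0 * (u * u + 1))) with 0 by ring.
    replace (0 * (0 * 0)) with 0 by ring.
    rewrite exp_0, cos_0, sin_0; field; nra. }
  apply RInt_of_is_derive.
  - intros u; apply is_derive_Reals, derivable_pt_lim_atan.
  - intros u; auto_derive; nra. }
rewrite H0.
assert (Hex : forall s, ex_derive (fun s => osc 1 0 1 0 s * RInt gauss 0 (1 * s)) s).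
{ intros s; apply @ex_derive_mult; [apply ex_derive_osc|].
  eexists; apply is_derive_scaled_primitive, ex_derive_gauss. }
(* For these parameters [osc] is the Gaussian itself, so the remaining integrand is the derivative
   of [E(s)^2]. *)
assert (H1 := RInt_of_is_derive (fun s => RInt gauss 0 s * RInt gauss 0 s)
  (fun s => 2 * (osc 1 0 1 0 s * RInt gauss 0 (1 * s))) 0 x).
rewrite <- (RInt_Rmult (fun s => osc 1 0 1 0 s * RInt gauss 0 (1 * s))), H1, RInt_point.
- unfold zero; simpl; ring.
- intros s.
  replace (osc 1 0 1 0 s) with (gauss s).
  2:{ unfold osc, gauss; rewrite !Rmult_0_l, cos_0, Rmult_1_l; ring. }
  rewrite Rmult_1_l.
  replace (2 * (gauss s * RInt gauss 0 s))
    with (gauss s * RInt gauss 0 s + RInt gauss 0 s * gauss s) by ring.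
  apply (is_derive_mult (fun s => RInt gauss 0 s) (fun s => RInt gauss 0 s));
    try (apply is_derive_RInt_upper, ex_derive_gauss).
  intros; apply Rmult_comm.
- intros s; apply ex_derive_scal, Hex.
- apply ex_RInt_of_ex_derive, Hex.
Qed.

Lemma gauss_primitive_ge_0 (x : R) : 0 <= x -> 0 <= RInt gauss 0 x.
Proof.
intros Hx; apply RInt_ge_0; [exact Hx|apply ex_RInt_of_ex_derive, ex_derive_gauss|].
intros; apply Rlt_le, exp_pos.
Qed.

(** In the constant sum [PI / 4] the second term is nonnegative, hence [E(x)^2 <= PI / 4]. *)
Lemma gauss_primitive_le (x : R) : 0 <= x -> RInt gauss 0 x <= sqrt PI / 2.
Proof.
intros Hx.
generalize (gauss_primitive_sqr x) (gauss_primitive_ge_0 x Hx) (sqrt_sqrt PI (Rlt_le _ _ PI_RGT_0))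
  (sqrt_lt_R0 PI PI_RGT_0); intros H1 H2 H3 H4.
assert (0 <= RInt (stieltjes 1 0 1 0 x) 0 1).
{ apply RInt_ge_0; [lra| |].
  - apply ex_RInt_of_ex_derive; intros; apply ex_derive_stieltjes_x; unfold denom; nra.
  - intros u _; unfold stieltjes, denom.
    rewrite !Rmult_0_l, cos_0, sin_0.
    apply Rmult_le_pos; [apply Rmult_le_pos; [apply Rlt_le, exp_pos|nra]|].
    apply Rlt_le, Rinv_0_lt_compat; nra. }
nra.
Qed.

Lemma exp_opp_le_inv (y : R) : 0 <= y -> exp (- y) <= / (1 + y).
Proof.
intros Hy; rewrite exp_Ropp; apply Rinv_le_contravar; [lra|].
destruct (Req_dec y 0) as [->|]; [rewrite exp_0; lra|].
left; apply exp_ineq1; lra.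
Qed.

(** The second term of the constant sum equals [(sqrt PI / 2 - E) (sqrt PI / 2 + E)] and is at most
    [1 / (1 + x^2)]; the factor [sqrt PI / 2 + E] is at least [sqrt PI / 2]. A rational rate
    suffices, since it integrates to an arctangent. *)
Lemma gauss_tail_le (x : R) :
  0 <= x -> sqrt PI / 2 - RInt gauss 0 x <= 2 / sqrt PI * / (1 + x * x).
Proof.
intros Hx.
generalize (gauss_primitive_sqr x) (gauss_primitive_ge_0 x Hx) (sqrt_sqrt PI (Rlt_le _ _ PI_RGT_0))
  (sqrt_lt_R0 PI PI_RGT_0) (gauss_primitive_le x Hx); intros H1 H2 H3 H4 H5.
assert (H6 : RInt (stieltjes 1 0 1 0 x) 0 1 <= (1 - 0) * / (1 + x * x)).
{ eapply Rle_trans; [apply Rle_abs|].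
  apply abs_RInt_le_const; [lra| |].
  - apply ex_RInt_of_ex_derive; intros; apply ex_derive_stieltjes_x; unfold denom; nra.
  - intros u _; unfold stieltjes, denom.
    rewrite !Rmult_0_l, cos_0, sin_0.
    replace (_ / _) with (exp (- (x * x * (u * u + 1))) / (u * u + 1)) by (field; nra).
    rewrite Rabs_pos_eq.
    2:{ apply Rlt_le, Rdiv_lt_0_compat; [apply exp_pos|nra]. }
    apply Rle_trans with (exp (- (x * x * (u * u + 1)))).
    { apply Rle_div_l; [nra|]. generalize (exp_pos (- (x * x * (u * u + 1)))); nra. }
    eapply Rle_trans; [apply exp_opp_le_inv; nra|].
    apply Rinv_le_contravar; nra. }
set (E := RInt gauss 0 x) in *. set (i := / (1 + x * x)) in *.
assert ((sqrt PI / 2 - E) * (sqrt PI / 2) <= i) by nra.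
replace (2 / sqrt PI * i) with (i / (sqrt PI / 2)) by (field; lra).
apply Rle_div_r; lra.
Qed.

(** * Limits at infinity *)

Lemma is_lim_of_rate (f : R -> R) (l C : R) :
  (forall x, 0 < x -> Rabs (f x - l) <= C / x) -> is_lim f p_infty l.
Proof.
intros H.
assert (Hinv : is_lim (fun x => / x) p_infty 0).
{ apply (is_lim_inv (fun x => x) p_infty p_infty); [apply is_lim_id|discriminate]. }
assert (HC : is_lim (fun x => C * / x) p_infty 0).
{ rewrite <- (Rmult_0_r C); exact (is_lim_scal_l (fun x => / x) C p_infty 0 Hinv). }
apply (is_lim_le_le_loc (fun x => l - C * / x) (fun x => l + C * / x)).
- exists 0; intros x Hx; generalize (H x Hx); unfold Rdiv.
  intros K; apply Rabs_le_between' in K; exact K.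
- rewrite <- (Rminus_0_r l) at 1; apply is_lim_minus'; [apply is_lim_const|exact HC].
- rewrite <- (Rplus_0_r l) at 1; apply is_lim_plus'; [apply is_lim_const|exact HC].
Qed.

Lemma is_lim_atan_p : is_lim atan p_infty (PI / 2).
Proof.
apply (is_lim_ext_loc (fun x => PI / 2 - atan (/ x))).
{ exists 0; intros x Hx; rewrite atan_inv; lra. }
replace (PI / 2) with (PI / 2 - atan 0) by (rewrite atan_0; ring).
apply is_lim_minus'; [rewrite atan_0, Rminus_0_r; apply is_lim_const|].
apply (is_lim_comp_continuous (fun x => / x) atan).
- apply (is_lim_inv (fun x => x) p_infty p_infty); [apply is_lim_id|discriminate].
- apply continuity_pt_filterlim, derivable_continuous_pt, derivable_pt_atan.
Qed.

(** * The Stieltjes integral as the cutoff [N] tends to infinity *)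

Lemma denom_ge (c S x : R) : S * S <= denom c S x.
Proof. generalize (Rle_0_sqr (x * x + c)); unfold denom, Rsqr; lra. Qed.

(** With [alpha = a^2], the factorization [x^2 + alpha = (x + i a) (x - i a)] makes the two
    quadratics the squared moduli of the linear factors. *)
Lemma denom_factor (a1 a2 x : R) :
  a1 * a1 + a2 * a2 = 1 ->
  denom (a1 * a1 - a2 * a2) (2 * a1 * a2) x =
  (x * x + 2 * a2 * x + 1) * (x * x - 2 * a2 * x + 1).
Proof.
intros H; unfold denom.
replace ((x * x + 2 * a2 * x + 1) * (x * x - 2 * a2 * x + 1)) with
  (x * x * (x * x) + 2 * (1 - 2 * (a2 * a2)) * (x * x) + 1 * 1) by ring.
rewrite <- H; ring.
Qed.

Lemma quadratic_pos (a1 a2 x : R) :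
  0 < a1 -> a1 * a1 + a2 * a2 = 1 -> 0 < x * x + 2 * a2 * x + 1.
Proof.
intros Ha H; generalize (Rle_0_sqr (x + a2)) (Rmult_lt_0_compat _ _ Ha Ha).
unfold Rsqr; lra.
Qed.

(** At [r = 0] the integrand is rational and partial fractions give the antiderivative [F]: the
    arctangents tend to [PI / 2] each and the logarithm tends to 0. *)
Lemma is_lim_RInt_stieltjes_0 (a1 a2 p q : R) :
  0 < a1 -> 0 < a2 -> a1 * a1 + a2 * a2 = 1 ->
  is_lim (fun N => RInt (stieltjes (a1 * a1 - a2 * a2) (2 * a1 * a2) p q 0) 0 N) p_infty
    (PI / 2 * (p * a1 + q * a2)).
Proof.
intros Ha1 Ha2 H1.
assert (Hp : forall x, 0 < x * x + 2 * a2 * x + 1) by (intros; now apply (quadratic_pos a1)).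
assert (Hm : forall x, 0 < x * x - 2 * a2 * x + 1).
{ intros x; generalize (Hp (- x)); lra. }
(* The coefficients come from [(p + i q) / a = 2 mu - 4 i nu], and [F] is the real part of this
   number times [arctan (x / a)]. *)
set (mu := (p * a1 + q * a2) / 2); set (nu := (p * a2 - q * a1) / 4).
set (F := fun x => mu * (atan ((x + a2) / a1) + atan ((x - a2) / a1)) +
  nu * ln ((x * x - 2 * a2 * x + 1) / (x * x + 2 * a2 * x + 1))).
apply (is_lim_ext F).
{ intros N; symmetry.
  rewrite (RInt_of_is_derive F).
  - replace (F 0) with 0; [apply Rminus_0_r|].
    unfold F.
    replace ((0 - a2) / a1) with (- ((0 + a2) / a1)) by (field; lra).
    replace ((0 * 0 - 2 * a2 * 0 + 1) / (0 * 0 + 2 * a2 * 0 + 1)) with 1 by field.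
    rewrite atan_opp, ln_1; ring.
  - intros x; unfold stieltjes; rewrite denom_factor by exact H1.
    replace (- (0 * 0 * (x * x + (a1 * a1 - a2 * a2)))) with 0 by ring.
    replace (2 * a1 * a2 * (0 * 0)) with 0 by ring.
    rewrite exp_0, cos_0, sin_0.
    unfold F.
    generalize (Hp x) (Hm x); intros Hpx Hmx.
    auto_derive.
    + repeat split; trivial; try lra. apply Rmult_lt_0_compat; trivial.
      now apply Rinv_0_lt_compat.
    + assert (E : forall d, d * d = a2 * a2 ->
        1 + (x + d) * / a1 * ((x + d) * / a1 * 1) = (x * x + 2 * d * x + 1) / (a1 * a1)).
      { intros d Hd.
        replace (x * x + 2 * d * x + 1) with (x * x + 2 * d * x + (a1 * a1 + d * d))
          by (rewrite Hd, H1; ring).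
        field; lra. }
      rewrite (E a2), (E (- a2)) by ring.
      replace (x * x + 2 * - a2 * x + 1) with (x * x - 2 * a2 * x + 1) by ring.
      (* Keeping [a1^2 + a2^2] as the coefficient of [x^2] makes the first equality a plain rational
         identity; the constraint enters only afterwards. *)
      transitivity ((p * ((a1 * a1 + a2 * a2) * (x * x) + (a1 * a1 - a2 * a2)) + q * (2 * a1 * a2)) /
        ((x * x + 2 * a2 * x + 1) * (x * x - 2 * a2 * x + 1))).
      { unfold mu, nu; field; lra. }
      rewrite H1; field; lra.
  - intros x; apply ex_derive_stieltjes_x; rewrite denom_factor by exact H1.
    generalize (Rmult_lt_0_compat _ _ (Hp x) (Hm x)); lra. }
replace (PI / 2 * (p * a1 + q * a2)) with (mu * (PI / 2 + PI / 2) + nu * 0) by (unfold mu; lra).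
assert (Hatan : forall d, is_lim (fun x => atan ((x + d) / a1)) p_infty (PI / 2)).
{ intros d; apply (is_lim_comp atan _ _ _ p_infty); [exact is_lim_atan_p| |].
  - apply is_lim_spec; intros M; exists (M * a1 - d); intros x Hx.
    apply Rlt_div_r; lra.
  - apply filter_forall; intros; discriminate. }
apply is_lim_plus'.
- apply (is_lim_scal_l (fun x => atan ((x + a2) / a1) + atan ((x - a2) / a1)) mu _ (PI / 2 + PI / 2)).
  apply is_lim_plus'; [apply Hatan|apply (Hatan (- a2))].
- rewrite <- ln_1.
  apply (is_lim_scal_l (fun x => ln ((x * x - 2 * a2 * x + 1) / (x * x + 2 * a2 * x + 1))) nu _ (ln 1)).
  apply (is_lim_comp_continuous _ ln).
  (* The quotient differs from 1 by [4 a2 x / (x^2 + 2 a2 x + 1)], which is at most [4 a2 / x]. *)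
  + apply (is_lim_of_rate _ _ (4 * a2)); intros x Hx.
    generalize (Hp x); intros Hpx.
    replace (_ - 1) with (- (4 * a2 * x / (x * x + 2 * a2 * x + 1))) by (field; lra).
    rewrite Rabs_Ropp, Rabs_pos_eq by (apply Rlt_le, Rdiv_lt_0_compat; nra).
    apply Rle_div_l; [lra|].
    replace (4 * a2 / x * (x * x + 2 * a2 * x + 1)) with
      (4 * a2 * x + 4 * a2 * (2 * a2 + / x)) by (field; lra).
    generalize (Rinv_0_lt_compat x Hx); intros; nra.
  + apply (ex_derive_continuous ln); auto_derive; lra.
Qed.

(** Since [c] may be negative, the exponential can grow; [Rabs c] and the endpoint [r] give a bound
    uniform in [s]. *)
Lemma osc_bound (c S p q r s : R) :
  0 <= s <= r -> Rabs (osc c S p q s) <= exp (Rabs c * (r * r)) * (Rabs p + Rabs q).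
Proof.
intros Hs; unfold osc; rewrite Rabs_mult.
rewrite (Rabs_pos_eq (exp _)) by (apply Rlt_le, exp_pos).
apply Rmult_le_compat; [apply Rlt_le, exp_pos|apply Rabs_pos| |].
- apply Rle_trans with (exp (Rabs c * (s * s))).
  + destruct (Rle_lt_or_eq_dec (- (c * (s * s))) (Rabs c * (s * s))) as [h|h].
    * rewrite <- Ropp_mult_distr_l_reverse; apply Rmult_le_compat_r; [nra|].
      rewrite <- Rabs_Ropp; apply Rle_abs.
    * left; now apply exp_increasing.
    * rewrite h; apply Rle_refl.
  + assert (Hle : Rabs c * (s * s) <= Rabs c * (r * r)).
    { apply Rmult_le_compat_l; [apply Rabs_pos|nra]. }
    destruct Hle as [h|h]; [left; now apply exp_increasing|rewrite h; apply Rle_refl].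
- eapply Rle_trans; [apply Rabs_triang|].
  rewrite !Rabs_mult.
  generalize (Rabs_pos p) (Rabs_pos q); intros.
  assert (Rabs (cos (S * (s * s))) <= 1) by (apply Rabs_le; apply COS_bound).
  assert (Rabs (sin (S * (s * s))) <= 1) by (apply Rabs_le; apply SIN_bound).
  nra.
Qed.

(** By the tail estimate the integrands differ by at most [K / (1 + N^2 s^2)], whose integral
    [K / N * atan (N r)] is at most [K (PI / 2) / N]. *)
Lemma is_lim_RInt_osc_gauss (c S p q r : R) :
  0 <= r ->
  is_lim (fun N => RInt (fun s => osc c S p q s * RInt gauss 0 (N * s)) 0 r) p_infty
    (sqrt PI / 2 * RInt (osc c S p q) 0 r).
Proof.
intros Hr.
set (K := exp (Rabs c * (r * r)) * (Rabs p + Rabs q) * (2 / sqrt PI)).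
assert (HK : 0 <= K).
{ unfold K; apply Rmult_le_pos; [apply Rmult_le_pos|].
  - apply Rlt_le, exp_pos.
  - generalize (Rabs_pos p) (Rabs_pos q); lra.
  - apply Rlt_le, Rdiv_lt_0_compat; [lra|apply sqrt_lt_R0, PI_RGT_0]. }
apply (is_lim_of_rate _ _ (K * (PI / 2))); intros N HN.
assert (Hex : forall s, ex_derive (fun s => osc c S p q s * RInt gauss 0 (N * s)) s).
{ intros s; apply @ex_derive_mult; [apply ex_derive_osc|].
  eexists; apply is_derive_scaled_primitive, ex_derive_gauss. }
rewrite <- RInt_Rmult by (apply ex_RInt_of_ex_derive, ex_derive_osc).
assert (Hex2 : forall s, ex_derive (fun s => sqrt PI / 2 * osc c S p q s) s).
{ intros s; apply ex_derive_scal, ex_derive_osc. }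
rewrite <- (RInt_minus (V := R_CompleteNormedModule));
  [|now apply ex_RInt_of_ex_derive|now apply ex_RInt_of_ex_derive].
assert (Hex3 : forall s, ex_derive (fun s => minus (osc c S p q s * RInt gauss 0 (N * s))
  (sqrt PI / 2 * osc c S p q s)) s).
{ intros s; now apply @ex_derive_minus. }
assert (Hex4 : forall s, ex_derive (fun s => K * / (1 + N * s * (N * s))) s).
{ intros s; auto_derive; nra. }
eapply Rle_trans; [apply abs_RInt_le; [exact Hr|now apply ex_RInt_of_ex_derive]|].
apply Rle_trans with (RInt (fun s => K * / (1 + N * s * (N * s))) 0 r).
- apply RInt_le; [exact Hr| |now apply ex_RInt_of_ex_derive|].
  + apply (ex_RInt_norm (fun s => minus (osc c S p q s * RInt gauss 0 (N * s))
      (sqrt PI / 2 * osc c S p q s))); now apply ex_RInt_of_ex_derive.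
  + intros s Hs; unfold minus, plus, opp; simpl.
    replace (_ + - _) with (- (osc c S p q s * (sqrt PI / 2 - RInt gauss 0 (N * s)))) by ring.
    rewrite Rabs_Ropp, Rabs_mult.
    assert (HNs : 0 <= N * s) by nra.
    generalize (gauss_primitive_le _ HNs) (gauss_tail_le _ HNs); intros G1 G2.
    rewrite (Rabs_pos_eq (_ - _)) by lra.
    unfold K; rewrite (Rmult_assoc (_ * _) (2 / sqrt PI)).
    apply Rmult_le_compat; [apply Rabs_pos|lra|apply osc_bound; lra|exact G2].
- rewrite (RInt_of_is_derive (fun s => K / N * atan (N * s))); [| |exact Hex4].
  + rewrite Rmult_0_r, atan_0.
    replace (K * (PI / 2) / N) with (K / N * (PI / 2)) by (field; lra).
    rewrite Rmult_0_r, Rminus_0_r.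
    apply Rmult_le_compat_l; [apply Rdiv_le_0_compat; lra|].
    generalize (atan_bound (N * r)); lra.
  + intros s; auto_derive; [trivial|]. generalize (Rle_0_sqr (N * s)); unfold Rsqr; intros; field; lra.
Qed.

(** Passage to the limit in [RInt_stieltjes_eq]; the Gaussian constant [sqrt PI] is written as
    [PI / 2 * (2 / sqrt PI)] to exhibit the normalization of [Erfc]. *)
Lemma is_lim_RInt_stieltjes (a1 a2 p q r : R) :
  0 < a1 -> 0 < a2 -> a1 * a1 + a2 * a2 = 1 -> 0 <= r ->
  let c := a1 * a1 - a2 * a2 in
  let S := 2 * a1 * a2 in
  is_lim (fun N => RInt (stieltjes c S p q r) 0 N) p_infty
    (PI / 2 * (p * a1 + q * a2 - 2 / sqrt PI * RInt (osc c S p q) 0 r)).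
Proof.
intros Ha1 Ha2 H1 Hr c S.
assert (HS : 0 < S) by (unfold S; generalize (Rmult_lt_0_compat _ _ Ha1 Ha2); lra).
apply (is_lim_ext (fun N => RInt (stieltjes c S p q 0) 0 N -
  2 * RInt (fun s => osc c S p q s * RInt gauss 0 (N * s)) 0 r)).
{ intros N; symmetry; apply RInt_stieltjes_eq; intros x.
  generalize (denom_ge c S x) (Rmult_lt_0_compat _ _ HS HS); lra. }
replace (PI / 2 * _) with (PI / 2 * (p * a1 + q * a2) - 2 * (sqrt PI / 2 * RInt (osc c S p q) 0 r)).
2:{ generalize (sqrt_lt_R0 PI PI_RGT_0); intros Hs.
  transitivity (PI / 2 * (p * a1 + q * a2) - PI / sqrt PI * RInt (osc c S p q) 0 r).
  - rewrite <- (sqrt_sqrt PI) at 4 by (generalize PI_RGT_0; lra); field; lra.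
  - field; lra. }
apply is_lim_minus'; [now apply is_lim_RInt_stieltjes_0|].
apply (is_lim_scal_l _ 2 _ (sqrt PI / 2 * RInt (osc c S p q) 0 r)).
now apply is_lim_RInt_osc_gauss.
Qed.

(** * The complex error function along a ray *)

Lemma osc_linear (c S p q s : R) : osc c S p q s = p * osc c S 1 0 s + q * osc c S 0 1 s.
Proof. unfold osc; ring. Qed.

Lemma RInt_osc_linear (c S p q r : R) :
  RInt (osc c S p q) 0 r = p * RInt (osc c S 1 0) 0 r + q * RInt (osc c S 0 1) 0 r.
Proof.
rewrite (RInt_of_is_derive
  (fun r => p * RInt (osc c S 1 0) 0 r + q * RInt (osc c S 0 1) 0 r)).
- rewrite !RInt_point; unfold zero; simpl; ring.
- intros x; rewrite osc_linear.
  apply @is_derive_plus; apply is_derive_scal, is_derive_RInt_upper;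
    intros; apply ex_derive_osc.
- intros; apply ex_derive_osc.
Qed.

(** On the segment [t z] with [z = r a], the exponent is [- alpha (r t)^2], so the substitution
    [s = r t] leaves [a] times the integral of [e^(- alpha s^2)] over [[0, r]]. *)
Lemma int0_gauss_ray (a1 a2 r : R) :
  let c := a1 * a1 - a2 * a2 in
  let S := 2 * a1 * a2 in
  int0_gauss (r * a1, r * a2) =
  Cmult (a1, a2) (RInt (osc c S 1 0) 0 r, - RInt (osc c S 0 1) 0 r).
Proof.
intros c S; unfold int0_gauss.
assert (HP : forall p q t,
  is_derive (fun t => RInt (osc c S p q) 0 (r * t)) t (r * osc c S p q (r * t))).
{ intros; apply is_derive_scaled_primitive; intros; apply ex_derive_osc. }
(* Both coordinates have this shape, with [(p, q)] equal to [(a1, a2)] and to [(a2, - a1)]. *)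
assert (HI : forall p q,
  is_RInt (fun t => p * (r * osc c S 1 0 (r * t)) + q * (r * osc c S 0 1 (r * t))) 0 1
    (p * RInt (osc c S 1 0) 0 r + q * RInt (osc c S 0 1) 0 r)).
{ intros p q.
  assert (Hex : forall t, ex_derive
    (fun t => p * (r * osc c S 1 0 (r * t)) + q * (r * osc c S 0 1 (r * t))) t).
  { intros t; unfold osc; auto_derive; trivial. }
  replace (p * RInt (osc c S 1 0) 0 r + q * RInt (osc c S 0 1) 0 r) with
    (RInt (fun t => p * (r * osc c S 1 0 (r * t)) + q * (r * osc c S 0 1 (r * t))) 0 1).
  - apply (RInt_correct (V := R_CompleteNormedModule)), ex_RInt_of_ex_derive, Hex.
  - rewrite (RInt_of_is_derive
      (fun t => p * RInt (osc c S 1 0) 0 (r * t) + q * RInt (osc c S 0 1) 0 (r * t))).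
    + rewrite Rmult_1_r, Rmult_0_r, !RInt_point; unfold zero; simpl; ring.
    + intros t; apply @is_derive_plus; apply is_derive_scal, HP.
    + exact Hex. }
apply (is_RInt_unique (V := C_R_CompleteNormedModule)).
apply (is_RInt_ext (V := C_R_CompleteNormedModule)
  (fun t => (a1 * (r * osc c S 1 0 (r * t)) + a2 * (r * osc c S 0 1 (r * t)),
             a2 * (r * osc c S 1 0 (r * t)) + - a1 * (r * osc c S 0 1 (r * t))))).
{ intros t _; unfold Cexp, Cmult, Copp, RtoC, osc, Re, Im; simpl.
  replace (- ((t * (r * a1) - 0 * (r * a2)) * (t * (r * a1) - 0 * (r * a2)) -
     (t * (r * a2) + 0 * (r * a1)) * (t * (r * a2) + 0 * (r * a1)))) with
    (- (c * (r * t * (r * t)))) by (unfold c; ring).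
  replace (- ((t * (r * a1) - 0 * (r * a2)) * (t * (r * a2) + 0 * (r * a1)) +
     (t * (r * a2) + 0 * (r * a1)) * (t * (r * a1) - 0 * (r * a2)))) with
    (- (S * (r * t * (r * t)))) by (unfold S; ring).
  rewrite cos_neg, sin_neg; f_equal; ring. }
replace (Cmult (a1, a2) (RInt (osc c S 1 0) 0 r, - RInt (osc c S 0 1) 0 r)) with
  (a1 * RInt (osc c S 1 0) 0 r + a2 * RInt (osc c S 0 1) 0 r,
   a2 * RInt (osc c S 1 0) 0 r + - a1 * RInt (osc c S 0 1) 0 r).
2:{ unfold Cmult; simpl; f_equal; ring. }
apply (is_RInt_fct_extend_pair (U := R_NormedModule) (V := R_NormedModule)); simpl; apply HI.
Qed.

(* [Re ((p + i q) Y)] for [Y = Erfc (r a) / a], where [a = (a1, a2)] has modulus 1. *)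
Definition erfc_form (a1 a2 p q r : R) : R :=
  let c := a1 * a1 - a2 * a2 in
  let S := 2 * a1 * a2 in
  p * (a1 - 2 / sqrt PI * RInt (osc c S 1 0) 0 r) +
  q * (a2 - 2 / sqrt PI * RInt (osc c S 0 1) 0 r).

Lemma is_lim_erfc_form (a1 a2 p q r : R) :
  0 < a1 -> 0 < a2 -> a1 * a1 + a2 * a2 = 1 -> 0 <= r ->
  is_lim (fun N => RInt (stieltjes (a1 * a1 - a2 * a2) (2 * a1 * a2) p q r) 0 N) p_infty
    (PI / 2 * erfc_form a1 a2 p q r).
Proof.
intros Ha1 Ha2 H1 Hr; generalize (is_lim_RInt_stieltjes a1 a2 p q r Ha1 Ha2 H1 Hr).
cbv zeta; rewrite RInt_osc_linear; intros H.
replace (erfc_form a1 a2 p q r) with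
  (p * a1 + q * a2 - 2 / sqrt PI *
    (p * RInt (osc (a1 * a1 - a2 * a2) (2 * a1 * a2) 1 0) 0 r +
     q * RInt (osc (a1 * a1 - a2 * a2) (2 * a1 * a2) 0 1) 0 r)); [exact H|].
unfold erfc_form; ring.
Qed.

(** * The imaginary part of [y]: derivative, sign and decay *)

(* [Im (e^(alpha t) Erfc (a sqrt t) / a)] with [alpha = a^2]. *)
Definition im_wofz (a1 a2 t : R) : R :=
  let c := a1 * a1 - a2 * a2 in
  let S := 2 * a1 * a2 in
  erfc_form a1 a2 (exp (c * t) * sin (S * t)) (- (exp (c * t) * cos (S * t))) (sqrt t).

(* [Im (alpha e^(alpha t) Erfc (a sqrt t) / a)]: the derivative of the inner
   square root contributes only a real term [- 1 / sqrt (pi t)]. *)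
Definition im_wofz' (a1 a2 t : R) : R :=
  let c := a1 * a1 - a2 * a2 in
  let S := 2 * a1 * a2 in
  erfc_form a1 a2 (exp (c * t) * (c * sin (S * t) + S * cos (S * t)))
    (exp (c * t) * (S * sin (S * t) - c * cos (S * t))) (sqrt t).

Lemma is_derive_im_wofz (a1 a2 t : R) :
  0 < t -> is_derive (im_wofz a1 a2) t (im_wofz' a1 a2 t).
Proof.
intros Ht; unfold im_wofz, im_wofz', erfc_form.
set (c := a1 * a1 - a2 * a2); set (S := 2 * a1 * a2); cbv zeta.
assert (HP := fun r => is_derive_RInt_upper (osc c S 1 0) 0 r (ex_derive_osc c S 1 0)).
assert (HQ := fun r => is_derive_RInt_upper (osc c S 0 1) 0 r (ex_derive_osc c S 0 1)).
set (P := fun r => RInt (osc c S 1 0) 0 r) in *.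
set (Q := fun r => RInt (osc c S 0 1) 0 r) in *.
change (is_derive (fun t : R => exp (c * t) * sin (S * t) * (a1 - 2 / sqrt PI * P (sqrt t)) +
    - (exp (c * t) * cos (S * t)) * (a2 - 2 / sqrt PI * Q (sqrt t))) t
  (exp (c * t) * (c * sin (S * t) + S * cos (S * t)) * (a1 - 2 / sqrt PI * P (sqrt t)) +
   exp (c * t) * (S * sin (S * t) - c * cos (S * t)) * (a2 - 2 / sqrt PI * Q (sqrt t)))).
(* Made opaque, [P] and [Q] are differentiated through the facts [HP] and [HQ] only. *)
clearbody P Q.
generalize (sqrt_lt_R0 PI PI_RGT_0) (sqrt_lt_R0 t Ht); intros Hpi Hst.
auto_derive.
- repeat split; trivial; eexists; [apply HP|apply HQ].
- replace (Derive (fun x => P x) (sqrt t)) with (osc c S 1 0 (sqrt t))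
    by (symmetry; apply is_derive_unique, HP).
  replace (Derive (fun x => Q x) (sqrt t)) with (osc c S 0 1 (sqrt t))
    by (symmetry; apply is_derive_unique, HQ).
  (* The contributions of the derivatives of [P] and [Q] are [sin cos] and [- cos sin] with equal
     factors, and they cancel. *)
  unfold osc; rewrite sqrt_sqrt by lra.
  field; lra.
Qed.

(** The multiplier [p + i q] is [- i e^(alpha r^2)]: it removes the oscillation and leaves the
    imaginary part of [e^(- r^2 x^2) / (x^2 + alpha)]. *)
Lemma stieltjes_im_wofz (c S r x : R) :
  stieltjes c S (exp (c * (r * r)) * sin (S * (r * r)))
    (- (exp (c * (r * r)) * cos (S * (r * r)))) r x =
  - (S / denom c S x * gauss (r * x)).
Proof.
unfold stieltjes, gauss, Rdiv.
transitivity (- (S * / denom c S x *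
  (exp (- (r * r * (x * x + c))) * exp (c * (r * r)) *
   ((sin (S * (r * r)))² + (cos (S * (r * r)))²)))).
{ unfold Rsqr; ring. }
rewrite sin2_cos2, Rmult_1_r, <- exp_plus; do 3 f_equal; ring.
Qed.

(** Here the multiplier is [- i alpha e^(alpha r^2)], and [alpha / (x^2 + alpha)] has imaginary part
    [S x^2 / |x^2 + alpha|^2]. *)
Lemma stieltjes_im_wofz' (c S r x : R) :
  stieltjes c S (exp (c * (r * r)) * (c * sin (S * (r * r)) + S * cos (S * (r * r))))
    (exp (c * (r * r)) * (S * sin (S * (r * r)) - c * cos (S * (r * r)))) r x =
  S * (x * x) / denom c S x * gauss (r * x).
Proof.
unfold stieltjes, gauss, Rdiv.
transitivity (S * (x * x) * / denom c S x *
  (exp (- (r * r * (x * x + c))) * exp (c * (r * r)) *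
   ((sin (S * (r * r)))² + (cos (S * (r * r)))²))).
{ unfold Rsqr; ring. }
rewrite sin2_cos2, Rmult_1_r, <- exp_plus; do 2 f_equal; ring.
Qed.

Lemma is_lim_ge (f : R -> R) (b l M : R) :
  (forall x, M < x -> b <= f x) -> is_lim f p_infty l -> b <= l.
Proof.
intros H Hf; apply (is_lim_le_loc (fun _ => b) f p_infty b l); [|apply is_lim_const|exact Hf].
now exists M.
Qed.

Lemma is_lim_le (f : R -> R) (b l M : R) :
  (forall x, M < x -> f x <= b) -> is_lim f p_infty l -> l <= b.
Proof.
intros H Hf; apply (is_lim_le_loc f (fun _ => b) p_infty l b); [|exact Hf|apply is_lim_const].
now exists M.
Qed.

(** A limit preserves only weak inequalities, so the truncated integrals are bounded below by their
    fixed, strictly positive part over [[0, 1]]. *)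
Lemma im_wofz'_pos (a1 a2 t : R) :
  0 < a1 -> 0 < a2 -> a1 * a1 + a2 * a2 = 1 -> 0 < t -> 0 < im_wofz' a1 a2 t.
Proof.
intros Ha1 Ha2 H1 Ht.
assert (HS : 0 < 2 * a1 * a2) by (generalize (Rmult_lt_0_compat _ _ Ha1 Ha2); lra).
replace t with (sqrt t * sqrt t) by (apply sqrt_sqrt; lra).
generalize (sqrt_lt_R0 t Ht); generalize (sqrt t); clear t Ht; intros r Hr.
unfold im_wofz'; cbv zeta; rewrite sqrt_square by lra.
set (p := exp _ * _); set (q := exp _ * _).
assert (Hlim := is_lim_erfc_form a1 a2 p q r Ha1 Ha2 H1 (Rlt_le _ _ Hr)).
set (S := 2 * a1 * a2) in *; set (c := a1 * a1 - a2 * a2) in *.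
assert (HD : forall x, 0 < denom c S x).
{ intros x; generalize (denom_ge c S x) (Rmult_lt_0_compat _ _ HS HS); lra. }
assert (Hex : forall x, ex_derive (stieltjes c S p q r) x).
{ intros x; apply ex_derive_stieltjes_x, Rgt_not_eq, HD. }
assert (Hpos : forall x, 0 < x -> 0 < stieltjes c S p q r x).
{ intros x Hx; unfold p, q; rewrite stieltjes_im_wofz'.
  apply Rmult_lt_0_compat; [|apply exp_pos].
  apply Rdiv_lt_0_compat; [|apply HD].
  apply Rmult_lt_0_compat; [exact HS|now apply Rmult_lt_0_compat]. }
assert (H01 : 0 < RInt (stieltjes c S p q r) 0 1).
{ apply RInt_gt_0; [lra|intros x Hx; apply Hpos; lra|].
  intros x _; apply (ex_derive_continuous (stieltjes c S p q r)), Hex. }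
generalize PI_RGT_0; intros Hpi.
apply (Rmult_lt_reg_l (PI / 2)); [lra|].
rewrite Rmult_0_r; apply Rlt_le_trans with (1 := H01).
apply (is_lim_ge _ _ _ 1) with (2 := Hlim); intros N HN.
rewrite <- (RInt_Chasles (stieltjes c S p q r) 0 1 N) by (apply ex_RInt_of_ex_derive, Hex).
rewrite <- (Rplus_0_r (RInt _ 0 1)) at 1.
apply Rplus_le_compat_l, RInt_ge_0; [lra|apply ex_RInt_of_ex_derive, Hex|].
intros x Hx; apply Rlt_le, Hpos; lra.
Qed.

(** Since [denom] is at least [S^2], the integrand lies between [- gauss (r x) / S] and 0, and the
    Gaussian integral contributes a factor [1 / r]. *)
Lemma im_wofz_bound (a1 a2 t : R) :
  0 < a1 -> 0 < a2 -> a1 * a1 + a2 * a2 = 1 -> 0 < t ->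
  - / (2 * a1 * a2 * sqrt t) <= im_wofz a1 a2 t <= 0.
Proof.
intros Ha1 Ha2 H1 Ht.
assert (HS : 0 < 2 * a1 * a2) by (generalize (Rmult_lt_0_compat _ _ Ha1 Ha2); lra).
replace (im_wofz a1 a2 t) with (im_wofz a1 a2 (sqrt t * sqrt t))
  by (rewrite sqrt_sqrt; lra).
generalize (sqrt_lt_R0 t Ht); generalize (sqrt t); clear t Ht; intros r Hr.
unfold im_wofz; cbv zeta; rewrite sqrt_square by lra.
set (p := exp _ * _); set (q := - (exp _ * _)).
assert (Hlim := is_lim_erfc_form a1 a2 p q r Ha1 Ha2 H1 (Rlt_le _ _ Hr)).
set (S := 2 * a1 * a2) in *; set (c := a1 * a1 - a2 * a2) in *.
assert (HD : forall x, 0 < denom c S x).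
{ intros x; generalize (denom_ge c S x) (Rmult_lt_0_compat _ _ HS HS); lra. }
assert (Hex : forall x, ex_derive (stieltjes c S p q r) x).
{ intros x; apply ex_derive_stieltjes_x, Rgt_not_eq, HD. }
assert (Hbound : forall x, - (/ S * gauss (r * x)) <= stieltjes c S p q r x <= 0).
{ intros x; unfold p, q; rewrite stieltjes_im_wofz.
  assert (Hg : 0 < gauss (r * x)) by apply exp_pos.
  assert (H0 : 0 < S / denom c S x) by (apply Rdiv_lt_0_compat; [exact HS|apply HD]).
  assert (S / denom c S x <= / S).
  { apply Rle_div_l; [apply HD|].
    replace S with (/ S * (S * S)) at 1 by (field; lra).
    apply Rmult_le_compat_l; [apply Rlt_le, Rinv_0_lt_compat, HS|apply denom_ge]. }
  split; [apply Ropp_le_contravar, Rmult_le_compat_r; lra|].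
  generalize (Rmult_lt_0_compat _ _ H0 Hg); lra. }
generalize PI_RGT_0; intros Hpi.
split; apply (Rmult_le_reg_l (PI / 2)); try lra.
- apply (is_lim_ge _ _ _ 0) with (2 := Hlim); intros N HN.
  assert (Hexg : forall x, ex_derive (fun x => - (/ S * gauss (r * x))) x).
  { intros x; unfold gauss; auto_derive; trivial. }
  apply Rle_trans with (RInt (fun x => - (/ S * gauss (r * x))) 0 N).
  + rewrite (RInt_of_is_derive (fun x => - / (S * r) * RInt gauss 0 (r * x))).
    * rewrite Rmult_0_r, RInt_point; unfold zero; simpl.
      assert (HrN : 0 <= r * N) by (apply Rmult_le_pos; lra).
      assert (Hi : 0 < / (S * r)) by (apply Rinv_0_lt_compat, Rmult_lt_0_compat; trivial).
      (* The weaker bound [PI / 2] is chosen to cancel the factor [PI / 2] of the representation. *)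
      assert (Hle : RInt gauss 0 (r * N) <= PI / 2).
      { eapply Rle_trans; [now apply gauss_primitive_le|].
        assert (sqrt PI <= PI); [|lra].
        rewrite <- (sqrt_sqrt PI) at 2 by lra.
        rewrite <- (Rmult_1_l (sqrt PI)) at 1.
        apply Rmult_le_compat_r; [apply sqrt_pos|].
        rewrite <- sqrt_1; apply sqrt_le_1_alt; generalize PI2_1; lra. }
      generalize (Rmult_le_compat_l _ _ _ (Rlt_le _ _ Hi) Hle); lra.
    * intros x.
      replace (- (/ S * gauss (r * x))) with (- / (S * r) * (r * gauss (r * x))) by (field; lra).
      apply is_derive_scal, is_derive_scaled_primitive, ex_derive_gauss.
    * exact Hexg.
  + apply RInt_le; [lra|now apply ex_RInt_of_ex_derive|now apply ex_RInt_of_ex_derive|].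
    intros; apply Hbound.
- rewrite Rmult_0_r.
  apply (is_lim_le _ _ _ 0) with (2 := Hlim); intros N HN.
  apply Rle_trans with (RInt (fun _ => 0) 0 N).
  + apply RInt_le; [lra|now apply ex_RInt_of_ex_derive|apply ex_RInt_const|].
    intros; apply Hbound.
  + rewrite RInt_const; unfold scal; simpl; unfold mult; simpl; lra.
Qed.

(** * Principal square roots and the real form of [u0] *)

Lemma Cmod_sqr (u v : R) : Cmod (u * u - v * v, 2 * u * v) = u * u + v * v.
Proof.
unfold Cmod; simpl.
replace (_ + _) with ((u * u + v * v)²) by (unfold Rsqr; ring).
apply sqrt_Rsqr; nra.
Qed.

Lemma Csqrt_upper (u v : R) :
  0 <= u -> 0 <= v -> Csqrt (u * u - v * v, 2 * u * v) = (u, v).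
Proof.
intros Hu Hv; unfold Csqrt; rewrite Cmod_sqr; simpl.
replace ((u * u + v * v + (u * u - v * v)) / 2) with (u * u) by field.
replace ((u * u + v * v - (u * u - v * v)) / 2) with (v * v) by field.
rewrite !sqrt_square by trivial.
destruct Rlt_dec as [h|_]; [exfalso; nra|f_equal; ring].
Qed.

(** On the negative real axis the principal root does not commute with conjugation, so [u = 0 < v]
    is excluded; [u = v = 0] is kept for [tau = 0]. *)
Lemma Csqrt_lower (u v : R) :
  0 <= u -> 0 <= v -> (u = 0 -> v = 0) -> Csqrt (u * u - v * v, - (2 * u * v)) = (u, - v).
Proof.
intros Hu Hv Huv.
unfold Csqrt; rewrite <- (Cmod_conj (_, _)); unfold Cconj; simpl.
rewrite Ropp_involutive, Cmod_sqr.
replace ((u * u + v * v + (u * u - v * v)) / 2) with (u * u) by field.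
replace ((u * u + v * v - (u * u - v * v)) / 2) with (v * v) by field.
rewrite !sqrt_square by trivial.
destruct Rlt_dec as [_|h]; f_equal; [ring|].
destruct (Req_dec u 0) as [h0|h0]; [rewrite Huv; trivial; ring|].
destruct (Req_dec v 0) as [->|h1]; [ring|].
exfalso; apply h; assert (0 < u * v) by (apply Rmult_lt_0_compat; lra); lra.
Qed.

Lemma wofz_div (a1 a2 t : R) :
  a1 * a1 + a2 * a2 = 1 -> 0 <= t ->
  let c := a1 * a1 - a2 * a2 in
  let S := 2 * a1 * a2 in
  Cdiv (Cmult (Cexp (c * t, S * t)) (Erfc (sqrt t * a1, sqrt t * a2))) (a1, a2) =
  Cmult (Cexp (c * t, S * t))
    (a1 - 2 / sqrt PI * RInt (osc c S 1 0) 0 (sqrt t),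
     - (a2 - 2 / sqrt PI * RInt (osc c S 0 1) 0 (sqrt t))).
Proof.
intros H1 Ht c S.
assert (Ha : (a1, a2) <> RtoC 0).
{ intros h; injection h; intros -> ->; lra. }
assert (Hinv : Cmult (a1, a2) (a1, - a2) = RtoC 1).
{ unfold Cmult, RtoC; simpl; f_equal; [rewrite <- H1|]; ring. }
unfold Erfc; rewrite int0_gauss_ray; fold c S.
(* Writing the 1 in [Erfc] as [a] times its conjugate lets [a] factor out and cancel the
   division. *)
rewrite <- Hinv at 1.
set (P := RInt _ 0 _); set (Q := RInt (osc c S 0 1) 0 _); set (E := Cexp _).
replace (a1 - 2 / sqrt PI * P, - (a2 - 2 / sqrt PI * Q)) with
  (Cminus (a1, - a2) (Cmult (RtoC (2 / sqrt PI)) (P, - Q))).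
2:{ unfold Cminus, Cplus, Copp, Cmult, RtoC; simpl; f_equal; ring. }
field; exact Ha.
Qed.

(** The two bracketed terms are conjugate, so they differ by [2 i Im y], while [sqrt kappa / (alpha
    - beta) = 2 a1 / (4 i a1 a2) = 1 / (2 i a2)]. *)
Lemma u0_eq (a1 a2 t : R) :
  0 < a1 -> 0 < a2 -> a1 * a1 + a2 * a2 = 1 -> 0 <= t ->
  let alpha := (a1 * a1 - a2 * a2, 2 * a1 * a2) in
  u0 (2 * a1 * (2 * a1)) alpha (Cconj alpha) t = RtoC (1 + im_wofz a1 a2 t / a2).
Proof.
intros Ha1 Ha2 H1 Ht alpha.
set (c := a1 * a1 - a2 * a2) in *; set (S := 2 * a1 * a2) in *.
assert (Hr := sqrt_pos t); assert (Hrr := sqrt_sqrt t Ht).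
assert (Hc : sqrt t * a1 * (sqrt t * a1) - sqrt t * a2 * (sqrt t * a2) = c * t).
{ rewrite <- Hrr at 5; unfold c; ring. }
assert (HS : 2 * (sqrt t * a1) * (sqrt t * a2) = S * t).
{ rewrite <- Hrr at 3; unfold S; ring. }
unfold u0, Cconj, alpha; simpl fst; simpl snd.
rewrite sqrt_square by lra.
replace (Cmult (c, S) (RtoC t)) with (c * t, S * t).
2:{ unfold Cmult, RtoC; simpl; f_equal; ring. }
replace (Cmult (c, - S) (RtoC t)) with (c * t, - (S * t)).
2:{ unfold Cmult, RtoC; simpl; f_equal; ring. }
replace (Csqrt (c * t, S * t)) with (sqrt t * a1, sqrt t * a2).
2:{ rewrite <- Csqrt_upper by (apply Rmult_le_pos; lra).
    now rewrite Hc, HS. }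
replace (Csqrt (c * t, - (S * t))) with (sqrt t * a1, sqrt t * - a2).
2:{ rewrite Ropp_mult_distr_r_reverse, <- Csqrt_lower.
    - now rewrite Hc, HS.
    - apply Rmult_le_pos; lra.
    - apply Rmult_le_pos; lra.
    - intros h; apply Rmult_integral in h; destruct h as [->|h]; [ring|lra]. }
replace (Csqrt (c, S)) with (a1, a2) by (symmetry; apply Csqrt_upper; lra).
replace (Csqrt (c, - S)) with (a1, - a2) by (symmetry; apply Csqrt_lower; lra).
assert (Hw := wofz_div a1 a2 t H1 Ht); cbv zeta in Hw; fold c S in Hw; rewrite Hw.
assert (Hw' := wofz_div a1 (- a2) t ltac:(rewrite <- H1; ring) Ht); cbv zeta in Hw'.
replace (a1 * a1 - - a2 * - a2) with c in Hw' by (unfold c; ring).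
replace (2 * a1 * - a2) with (- S) in Hw' by (unfold S; ring).
rewrite (Ropp_mult_distr_l_reverse S t) in Hw'; rewrite Hw'.
(* Conjugation flips the sign of [S]: the cosine integral is unchanged and the sine integral changes
   sign. *)
rewrite (RInt_Rext (osc c (- S) 1 0) (osc c S 1 0)).
2:{ intros s; unfold osc; rewrite Ropp_mult_distr_l_reverse, cos_neg, sin_neg; ring. }
rewrite (RInt_Rext (osc c (- S) 0 1) (fun s => -1 * osc c S 0 1 s)).
2:{ intros s; unfold osc; rewrite Ropp_mult_distr_l_reverse, cos_neg, sin_neg; ring. }
rewrite RInt_Rmult by (apply ex_RInt_of_ex_derive, ex_derive_osc).
unfold im_wofz, erfc_form; cbv zeta; fold c S.
set (P := RInt _ 0 _); set (Q := RInt (osc c S 0 1) 0 _).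
unfold Cexp; simpl Re; simpl Im; rewrite cos_neg, sin_neg.
replace (Cdiv (RtoC (2 * a1)) (Cminus (c, S) (c, - S))) with (0, - / (2 * a2)).
2:{ replace (Cminus (c, S) (c, - S)) with (0, 2 * S).
    2:{ unfold Cminus, Cplus, Copp; simpl; f_equal; ring. }
    replace (RtoC (2 * a1)) with (Cmult (0, - / (2 * a2)) (0, 2 * S)).
    2:{ unfold Cmult, RtoC, S; simpl; f_equal; field; lra. }
    assert (Hdiv : forall z w : C, w <> RtoC 0 -> z = Cdiv (Cmult z w) w).
    { intros z w Hw0; field; exact Hw0. }
    apply Hdiv; intros h; injection h; unfold S.
    generalize (Rmult_lt_0_compat _ _ Ha1 Ha2); lra. }
generalize (sqrt_lt_R0 PI PI_RGT_0); intros Hpi.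
unfold Cminus, Cplus, Copp, Cmult, RtoC; simpl; f_equal; field; lra.
Qed.

(** * Parametrization by [sqrt alpha], monotonicity and convergence *)

Theorem theorem3p1 (kappa : R) (alpha : C) :
  0 < kappa < 4 ->
  Cplus (Cplus (Cmult alpha alpha) (Cmult (RtoC (2 - kappa)) alpha)) (RtoC 1) = RtoC 0 ->
  0 < Im alpha ->
  let beta := Cconj alpha in
  (forall tau : R, 0 <= tau -> Im (u0 kappa alpha beta tau) = 0) /\
  (forall tau : R, 0 < tau ->
     ex_derive (fun t => Re (u0 kappa alpha beta t)) tau /\
     0 < Derive (fun t => Re (u0 kappa alpha beta t)) tau) /\
  filterlim (u0 kappa alpha beta) (Rbar_locally p_infty) (locally (RtoC 1)).
Proof.
intros Hk Heq Him beta.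
destruct alpha as [x y]; simpl in Him.
assert (Hxy : x = (kappa - 2) / 2 /\ x * x + y * y = 1).
{ assert (Hre := f_equal Re Heq); assert (Himq := f_equal Im Heq).
  unfold Cplus, Cmult, RtoC, Re, Im in Hre, Himq; simpl in Hre, Himq.
  assert (Hx : x = (kappa - 2) / 2).
  (* The imaginary part of the equation is [y (2 x + 2 - kappa) = 0]. *)
  { apply (Rmult_eq_reg_l y); lra. }
  split; [exact Hx|].
  replace (2 - kappa) with (- 2 * x) in Hre by lra; lra. }
destruct Hxy as [Hx Hxy].
assert (Halpha : exists a1 a2, 0 < a1 /\ 0 < a2 /\ a1 * a1 + a2 * a2 = 1 /\
  kappa = 2 * a1 * (2 * a1) /\ x = a1 * a1 - a2 * a2 /\ y = 2 * a1 * a2).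
(* Half-angle formulas for the square root of a number of modulus 1; [0 < kappa < 4] gives
   [-1 < x < 1]. *)
{ exists (sqrt ((1 + x) / 2)), (sqrt ((1 - x) / 2)).
  assert (H1 : 0 < (1 + x) / 2) by lra.
  assert (H2 : 0 < (1 - x) / 2) by lra.
  assert (E1 := sqrt_sqrt _ (Rlt_le _ _ H1)).
  assert (E2 := sqrt_sqrt _ (Rlt_le _ _ H2)).
  repeat split; try (now apply sqrt_lt_R0); try lra.
  rewrite Rmult_assoc, <- sqrt_mult by lra.
  replace ((1 + x) / 2 * ((1 - x) / 2)) with ((y / 2) * (y / 2)).
  - rewrite sqrt_square; lra.
  - replace ((1 + x) / 2 * ((1 - x) / 2)) with ((1 - x * x) / 4) by field.
    rewrite <- Hxy; field. }
destruct Halpha as (a1 & a2 & Ha1 & Ha2 & H1 & -> & -> & ->).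
assert (Hu : forall t, 0 <= t ->
  u0 (2 * a1 * (2 * a1)) (a1 * a1 - a2 * a2, 2 * a1 * a2) beta t =
  RtoC (1 + im_wofz a1 a2 t / a2)).
{ intros; now apply u0_eq. }
clearbody beta.
assert (Hd : forall t, 0 < t -> is_derive (fun t =>
  Re (u0 (2 * a1 * (2 * a1)) (a1 * a1 - a2 * a2, 2 * a1 * a2) beta t)) t
  (/ a2 * im_wofz' a1 a2 t)).
{ intros t Ht; apply (is_derive_ext_loc (fun t => 1 + / a2 * im_wofz a1 a2 t)).
  (* The closed form is known for nonnegative times only; the ball of radius [t] around [t] stays
     among them. *)
  - exists (mkposreal t Ht); intros s Hs.
    apply Rabs_def2 in Hs; unfold minus, plus, opp in Hs; simpl in Hs.
    rewrite Hu by lra; simpl; field; lra.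
  - rewrite <- (Rplus_0_l (_ * _)).
    apply @is_derive_plus; [apply @is_derive_const|].
    now apply is_derive_scal, is_derive_im_wofz. }
split; [|split].
- intros t Ht; rewrite Hu by exact Ht; reflexivity.
- intros t Ht; split; [eexists; now apply Hd|].
  apply (Rlt_le_trans _ (/ a2 * im_wofz' a1 a2 t));
    [|right; symmetry; apply is_derive_unique, Hd, Ht].
  apply Rmult_lt_0_compat; [now apply Rinv_0_lt_compat|now apply im_wofz'_pos].
- apply filterlim_locally; intros eps.
  set (k := / (a2 * (2 * a1 * a2))).
  assert (Hk0 : 0 < k).
  { apply Rinv_0_lt_compat; repeat apply Rmult_lt_0_compat; lra. }
  assert (Hke : 0 < k / eps) by (apply Rdiv_lt_0_compat; [exact Hk0|apply cond_pos]).
  (* The deviation from 1 is at most [k / sqrt t], which is below [eps] once [t] exceeds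
     [(k / eps)^2]. *)
  exists (k / eps * (k / eps)); intros t Ht.
  assert (Ht0 : 0 < t) by nra.
  rewrite Hu by lra.
  assert (Hs : k / eps < sqrt t).
  { rewrite <- (sqrt_square (k / eps)) by lra; apply sqrt_lt_1_alt; nra. }
  (* Balls in [C] are taken coordinatewise, and the imaginary part is exactly 0. *)
  split; [|apply ball_center].
  destruct (im_wofz_bound a1 a2 t Ha1 Ha2 H1 Ht0) as [Hlo Hhi].
  assert (Hia : 0 < / a2) by now apply Rinv_0_lt_compat.
  apply (Rmult_le_compat_l (/ a2)) in Hlo; [|lra].
  apply (Rmult_le_compat_l (/ a2)) in Hhi; [|lra].
  replace (/ a2 * - / (2 * a1 * a2 * sqrt t)) with (- (k / sqrt t)) in Hlo
    by (unfold k; field; lra).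
  assert (k / sqrt t < eps).
  { apply Rlt_div_l; [lra|].
    apply Rlt_div_l in Hs; [lra|apply cond_pos]. }
  apply Rabs_def1; unfold minus, plus, opp; simpl; unfold Rdiv; generalize (cond_pos eps); lra.
Qed.
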